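(* Let $H$ be an infinite dimensional Hilbert space, $\tilde p_0$ the orthogonal projection of $H\times H$ onto $H\times\{0\}$, and $\mathcal{R}$ the Riemann sphere of $B(H)$. Then $\{P\in\mathcal{R}:\|\tilde p_0-P\|<1\}$ is not dense in $\mathcal{R}$.
   Context: $\mathcal{R}=\{\tilde u\tilde p_0\tilde u^*:\tilde u\text{ unitary in }B(H\oplus H)\}$ with $\tilde p_0=\begin{pmatrix}1&0\\0&0\end{pmatrix}$, with the operator norm topology. *)

(* Defs.v *)
From HB Require Import structures.
From mathcomp Require Import all_boot all_order all_algebra.
From mathcomp Require Import complex ring.
From mathcomp Require Import all_classical all_reals all_analysis.
Set Implicit Arguments.
Unset Strict Implicit.
Unset Printing Implicit Defensive.
Import Order.TTheory GRing.Theory Num.Theory.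
Import numFieldNormedType.Exports.
Local Open Scope classical_set_scope.
Local Open Scope ring_scope.
Local Open Scope complex_scope.

(* Complex Hilbert spaces: complete normed modules over R[i] whose norm comes
   from an inner product.  As in sesquilinear.v, the form is linear in its
   first argument and conjugate linear in the second. *)
HB.mixin Record CompleteNormedModule_isHilbert (R : realType) H
    & CompleteNormedModule R[i] H := {
  inner : {dot H for (@Num.conj_op R[i])} ;
  innerE : forall x : H, inner x x = `|x| ^+ 2
}.

#[short(type="hilbertType")]
HB.structure Definition Hilbert (R : realType) :=
  {H of CompleteNormedModule R[i] H & CompleteNormedModule_isHilbert R H}.

Definition finite_dimensional (K : fieldType) (V : lmodType K) :=
  exists n (e : 'I_n -> V), forall x, exists c : 'I_n -> K,
    x = \sum_(i < n) c i *: e i.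
Arguments finite_dimensional {K} V.

(* The Hilbert direct sum.  The type H * K itself already carries the sup norm
   of the library, hence the alias. *)
Definition hsum (R : realType) (H K : hilbertType R) : Type := (H * K)%type.

Section hsum_normed.
Context {R : realType} {H K : hilbertType R}.
Implicit Types x y : hsum H K.

HB.instance Definition _ := GRing.Lmodule.copy (hsum H K) (H * K)%type.

Definition hsum_norm x : R[i] := sqrtC (`|x.1| ^+ 2 + `|x.2| ^+ 2).

Lemma hsum_norm_sqr x : hsum_norm x ^+ 2 = `|x.1| ^+ 2 + `|x.2| ^+ 2.
Proof. by rewrite /hsum_norm sqrtCK. Qed.

Lemma hsum_norm_ge0 x : 0 <= hsum_norm x.
Proof. by rewrite sqrtC_ge0 addr_ge0// exprn_ge0. Qed.

Lemma hsum_normD x y : hsum_norm (x + y) <= hsum_norm x + hsum_norm y.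
Proof.
have nn z : hsum_norm z \is Num.nneg by rewrite nnegrE hsum_norm_ge0.
rewrite -(@ler_sqr R[i]) ?rpredD//.
rewrite sqrrD !hsum_norm_sqr.
have le2 (V : normedModType R[i]) (u v : V) :
    `|u + v| ^+ 2 <= `|u| ^+ 2 + `|u| * `|v| *+ 2 + `|v| ^+ 2.
  by rewrite -sqrrD ler_sqr ?nnegrE ?addr_ge0// ler_normD.
apply: (le_trans (lerD (le2 _ _ _) (le2 _ _ _))).
set a := `|x.1|; set b := `|y.1|; set c := `|x.2|; set d := `|y.2|.
have [a0 b0 c0 d0] : [/\ 0 <= a, 0 <= b, 0 <= c & 0 <= d] by split; apply: normr_ge0.
have cs : a * b + c * d <= hsum_norm x * hsum_norm y.
  rewrite -(@ler_sqr R[i]) ?nnegrE ?addr_ge0 ?mulr_ge0 ?hsum_norm_ge0//.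
  rewrite exprMn !hsum_norm_sqr -/a -/b -/c -/d -subr_ge0.
  have -> : (a ^+ 2 + c ^+ 2) * (b ^+ 2 + d ^+ 2) - (a * b + c * d) ^+ 2 =
      (a * d - c * b) ^+ 2.
    by ring.
  by rewrite real_exprn_even_ge0// rpredB// ger0_real// mulr_ge0.
rewrite -subr_ge0.
set h := hsum_norm x * _.
have -> : a ^+ 2 + c ^+ 2 + h *+ 2 + (b ^+ 2 + d ^+ 2) -
   (a ^+ 2 + a * b *+ 2 + b ^+ 2 + (c ^+ 2 + c * d *+ 2 + d ^+ 2)) =
   (h - (a * b + c * d)) *+ 2 by ring.
by rewrite mulrn_wge0// subr_ge0.
Qed.

Lemma hsum_normZ (l : R[i]) x : hsum_norm (l *: x) = `|l| * hsum_norm x.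
Proof.
apply/eqP; rewrite -(@eqrXn2 _ 2) ?mulr_ge0 ?hsum_norm_ge0//.
by rewrite exprMn !hsum_norm_sqr /= !normrZ !exprMn mulrDr.
Qed.

Lemma hsum_norm_eq0 x : hsum_norm x = 0 -> x = 0.
Proof.
move=> /eqP; rewrite sqrtC_eq0 paddr_eq0 ?exprn_ge0// !expf_eq0/= !normr_eq0.
by case: x => x1 x2 /= /andP[/eqP-> /eqP->].
Qed.

HB.instance Definition _ := @Lmodule_isNormed.Build R[i] (hsum H K)
  hsum_norm hsum_normD hsum_normZ hsum_norm_eq0.

Lemma hsum_normE x : `|x| = sqrtC (`|x.1| ^+ 2 + `|x.2| ^+ 2).
Proof. by []. Qed.

Lemma hsum_norm1 x : `|x.1| <= `|x|.
Proof.
rewrite -(@ler_sqr R[i]) ?nnegrE//= hsum_normE sqrtCK.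
by rewrite lerDl exprn_ge0.
Qed.

Lemma hsum_norm2 x : `|x.2| <= `|x|.
Proof.
rewrite -(@ler_sqr R[i]) ?nnegrE//= hsum_normE sqrtCK.
by rewrite lerDr exprn_ge0.
Qed.

Lemma hsum_norm_le x : `|x| <= `|x.1| + `|x.2|.
Proof.
rewrite -(@ler_sqr R[i]) ?nnegrE ?addr_ge0//= hsum_normE sqrtCK.
by rewrite sqrrD addrAC lerDl mulrn_wge0// mulr_ge0.
Qed.

Lemma hsum_complete (F : set_system (hsum H K)) :
  ProperFilter F -> cauchy F -> cvg F.
Proof.
move=> FF /cauchy_ballP cF.
have cauchy_img (V : completeNormedModType R[i]) (g : hsum H K -> V) :
    (forall u v, `|g u - g v| <= `|u - v|) -> cauchy (g @ F).
  move=> g1; apply/cauchy_ballP => e e0.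
  have [[A B] /= [FA FB] AB] := cF e e0.
  exists (g @` A, g @` B) => /=.
    split; [apply: filterS FA|apply: filterS FB] => u Hu; by exists u.
  case=> _ _ [/= [u Au <-] [v Bv <-]].
  have /= := AB (u, v) (conj Au Bv); rewrite -!ball_normE /=.
  exact: le_lt_trans.
have c1 : cauchy ((fst : hsum H K -> H) @ F).
  by apply: cauchy_img => u v; exact: (hsum_norm1 (u - v)).
have c2 : cauchy ((snd : hsum H K -> K) @ F).
  by apply: cauchy_img => u v; exact: (hsum_norm2 (u - v)).
have cv1 := @cauchy_cvg H _ (fmap_proper_filter _ FF) c1.
have cv2 := @cauchy_cvg K _ (fmap_proper_filter _ FF) c2.
set l1 := lim _ in cv1; set l2 := lim _ in cv2.
have /cvgrPdist_lt h1 := cv1; have /cvgrPdist_lt h2 := cv2.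
apply: (@cvgP _ _ ((l1, l2) : hsum H K)); apply/cvgrPdist_lt => e e0.
have e20 : 0 < e / 2 by rewrite divr_gt0.
have /= f1 := h1 _ e20; have /= f2 := h2 _ e20.
near=> z; rewrite (splitr e).
apply: (le_lt_trans (hsum_norm_le _)); rewrite ltrD//=.
  by near: z.
by near: z.
Unshelve. all: by end_near. Qed.

HB.instance Definition _ := Uniform_isComplete.Build (hsum H K) hsum_complete.

Definition hsum_inner x y : R[i] := inner x.1 y.1 + inner x.2 y.2.

Lemma hsum_innerE x : hsum_inner x x = `|x| ^+ 2.
Proof. by rewrite /hsum_inner !innerE hsum_normE sqrtCK. Qed.

Lemma hsum_inner_bilinear :
  bilinear_for *%R (@Num.conj_op R[i] \; *%R) hsum_inner.
Proof.
split=> u a x y; rewrite /hsum_inner /=.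
  by rewrite !linearPl/= mulrDr addrACA.
by rewrite !linearPr/= mulrDr addrACA.
Qed.

HB.instance Definition _ := bilinear_isBilinear.Build R[i] _ _ R[i] *%R
  (@Num.conj_op R[i] \; *%R) hsum_inner hsum_inner_bilinear.

Lemma hsum_inner_hermitian x y :
  hsum_inner x y = (-1) ^+ false * Num.conj_op (hsum_inner y x).
Proof.
by rewrite /hsum_inner (hermC _ x.1) (hermC _ x.2) rmorphD /= !expr0 !mul1r.
Qed.

HB.instance Definition _ := isHermitianSesquilinear.Build R[i] _ false
  (@Num.conj_op R[i]) hsum_inner hsum_inner_hermitian.

Lemma hsum_inner_gt0 x : x != 0 -> 0 < hsum_inner x x.
Proof. by move=> x0; rewrite hsum_innerE exprn_gt0// normr_gt0. Qed.

HB.instance Definition _ := isDotProduct.Build R[i] _ hsum_inner hsum_inner_gt0.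

HB.instance Definition _ := CompleteNormedModule_isHilbert.Build R (hsum H K)
  hsum_innerE.

End hsum_normed.

Definition bounded_linear (K : numFieldType) (V W : normedModType K)
    : {pred V -> W} :=
  fun f => `[< linear f /\ exists M : K, forall x, `|f x| <= M * `|x| >].

(* B(H, K), as a normed module for the operator norm. *)
Record boundedOp (R : realType) (H K : hilbertType R) := BoundedOp {
  boundedOp_fun :> H -> K ;
  boundedOpP : boundedOp_fun \in @bounded_linear R[i] H K
}.

Section boundedOp_normed.
Context {R : realType} {H K : hilbertType R}.

HB.instance Definition _ := [isSub for @boundedOp_fun R H K].
HB.instance Definition _ := [Choice of boundedOp H K by <:].

Lemma bounded_linear_submod : submod_closed (@bounded_linear R[i] H K).
Proof.
split.
  apply/asboolP; split=> [a x y|]; first by rewrite /= scaler0 addr0.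
  by exists 0 => x; rewrite /= normr0 mul0r.
move=> a f g /asboolP[lf [M fM]] /asboolP[lg [N gN]]; apply/asboolP; split.
  move=> b x y; rewrite !fctE lf lg !scalerDr !scalerA [a * b]mulrC.
  by rewrite addrACA.
exists (`|a| * M + N) => x; rewrite !fctE mulrDl -mulrA.
by rewrite (le_trans (ler_normD _ _))// lerD// normrZ ler_wpM2l.
Qed.

HB.instance Definition _ := GRing.isSubmodClosed.Build R[i] (H -> K)
  (@bounded_linear R[i] H K) bounded_linear_submod.
HB.instance Definition _ := [SubChoice_isSubLmodule of boundedOp H K by <:].

Implicit Types S T : boundedOp H K.

Lemma boundedOp_linear T : linear T.
Proof. by case: T => f /= /asboolP[]. Qed.

HB.instance Definition _ T := GRing.isLinear.Build R[i] H K *:%R T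
  (boundedOp_linear T).

Lemma boundedOp_bounded T : exists M : R[i], forall x, `|T x| <= M * `|x|.
Proof. by case: T => f /= /asboolP[]. Qed.

(* The norms take their values in R[i], whence the detour through R. *)
Definition op_norm T : R[i] :=
  (sup [set complex.Re `|T x| | x in [set x : H | `|x| <= 1]])%:C.

Lemma Re_ge0K (z : R[i]) : 0 <= z -> (complex.Re z)%:C = z.
Proof. by move=> z0; rewrite RRe_real// ger0_real. Qed.

Lemma op_norm_has_sup T :
  has_sup [set complex.Re `|T x| | x in [set x : H | `|x| <= 1]].
Proof.
split; first by exists (complex.Re `|T 0|), 0 => //=; rewrite normr0.
have [M TM] := boundedOp_bounded T.
have M0 : M \is Num.real \/ forall x, `|T x| = 0 /\ `|x : H| = 0.
  have [x0|] := pselect (exists x : H, x != 0).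
    left; have [x x0'] := x0; have xp : 0 < `|x| by rewrite normr_gt0.
    have := le_trans (normr_ge0 _) (TM x).
    by rewrite pmulr_lge0// => /ger0_real.
  move=> /forallNP h; right => x; have /negP/negbNE/eqP-> := h x.
  by rewrite linear0 !normr0.
case: M0 => [Mr|h].
  exists (complex.Re `|M|) => _ [x x1 <-]; rewrite -lecR !Re_ge0K//.
  apply: (le_trans (TM x)); apply: (@le_trans _ _ (`|M| * `|x|)).
    by rewrite ler_wpM2r// real_ler_norm.
  by rewrite ler_piMr.
by exists 0 => _ [x _ <-]; rewrite (h x).1.
Qed.

Lemma op_norm_ge0 T : 0 <= op_norm T.
Proof.
rewrite ler0c; apply: (@le_trans _ _ (complex.Re `|T 0|)).
  by rewrite -ler0c Re_ge0K.
by apply: ub_le_sup; [have [] := op_norm_has_sup T|exists 0 => //=; rewrite normr0].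
Qed.

Lemma op_norm_ub T x : `|T x| <= op_norm T * `|x|.
Proof.
have [->|x0] := eqVneq x 0; first by rewrite linear0 !normr0 mulr0.
have xp : 0 < `|x| by rewrite normr_gt0.
rewrite -ler_pdivrMr//.
have -> : `|T x| / `|x| = `|T (`|x|^-1 *: x)|.
  by rewrite linearZ/= normrZ normfV normr_id mulrC.
rewrite -[leLHS]Re_ge0K// lecR; apply: ub_le_sup.
  by have [] := op_norm_has_sup T.
by exists (`|x|^-1 *: x) => //=; rewrite normrZ normfV normr_id mulVf// gt_eqF.
Qed.

Lemma op_norm_le T (M : R[i]) :
  0 <= M -> (forall x, `|T x| <= M * `|x|) -> op_norm T <= M.
Proof.
move=> M0 TM; rewrite -[M]Re_ge0K// lecR; apply: ge_sup.
  by have [] := op_norm_has_sup T.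
move=> _ [x /= x1 <-]; rewrite -lecR !Re_ge0K// (le_trans (TM x))//.
by rewrite ler_piMr.
Qed.

Lemma op_normD S T : op_norm (S + T) <= op_norm S + op_norm T.
Proof.
apply: op_norm_le => [|x]; first by rewrite addr_ge0// op_norm_ge0.
by rewrite mulrDl (le_trans (ler_normD _ _))// lerD// op_norm_ub.
Qed.

Lemma op_normZ (l : R[i]) T : op_norm (l *: T) = `|l| * op_norm T.
Proof.
have le1 (a : R[i]) (S : boundedOp H K) : op_norm (a *: S) <= `|a| * op_norm S.
  apply: op_norm_le => [|x]; first by rewrite mulr_ge0// op_norm_ge0.
  by rewrite -mulrA normrZ ler_wpM2l// op_norm_ub.
have [->|l0] := eqVneq l 0.
  apply/eqP; rewrite normr0 mul0r eq_le op_norm_ge0 andbT.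
  by rewrite (le_trans (le1 _ _))// normr0 mul0r.
apply/eqP; rewrite eq_le le1/= -ler_pdivlMl ?normr_gt0// -normfV.
by rewrite (le_trans _ (le1 _ _))// scalerA mulVf// scale1r.
Qed.

Lemma op_norm_eq0 T : op_norm T = 0 -> T = 0.
Proof.
move=> T0; apply/val_inj/funext => x /=; apply/eqP; rewrite -normr_le0.
by rewrite (le_trans (op_norm_ub T x))// T0 mul0r.
Qed.

HB.instance Definition _ := @Lmodule_isNormed.Build R[i] (boundedOp H K)
  op_norm op_normD op_normZ op_norm_eq0.

End boundedOp_normed.

Section operators.
Context {R : realType}.
Implicit Types H K L : hilbertType R.

Lemma id_bounded H : (idfun : H -> H) \in @bounded_linear R[i] H H.
Proof. by apply/asboolP; split=> //; exists 1 => x; rewrite mul1r. Qed.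

Definition op_id H : boundedOp H H := BoundedOp (id_bounded H).

Lemma comp_bounded H K L (S : boundedOp K L) (T : boundedOp H K) :
  (S \o T) \in @bounded_linear R[i] H L.
Proof.
apply/asboolP; split=> [a x y|]; first by rewrite /= !linearP.
exists (op_norm S * op_norm T) => x; apply: le_trans (op_norm_ub S _) _.
by rewrite -mulrA ler_wpM2l ?op_norm_ge0// op_norm_ub.
Qed.

Definition op_comp H K L (S : boundedOp K L) (T : boundedOp H K) :
  boundedOp H L := BoundedOp (comp_bounded S T).

(* S is the (unique) Hilbert space adjoint of T. *)
Definition is_adjoint H K (T : boundedOp H K) (S : boundedOp K H) :=
  forall x y, inner (T x) y = inner x (S y).

Definition unitary H (U : boundedOp H H) :=
  exists V, [/\ is_adjoint U V, op_comp U V = op_id H & op_comp V U = op_id H].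

(* The orthogonal projection of H (+) H onto H (+) 0. *)
Definition proj0_fun H (x : hsum H H) : hsum H H := (x.1, 0).

Lemma proj0_bounded H :
  @proj0_fun H \in @bounded_linear R[i] (hsum H H) (hsum H H).
Proof.
apply/asboolP; split=> [a x y|]; first by congr pair; rewrite /= scaler0 addr0.
exists 1 => x; rewrite mul1r (le_trans (hsum_norm_le _))//=.
by rewrite normr0 addr0 hsum_norm1.
Qed.

Definition proj0 H : boundedOp (hsum H H) (hsum H H) :=
  BoundedOp (proj0_bounded H).

Definition riemann_sphere H : set (boundedOp (hsum H H) (hsum H H)) :=
  [set P | exists U V, [/\ unitary U, is_adjoint U V &
                          P = op_comp (op_comp U (proj0 H)) V]].

End operators.

Arguments riemann_sphere {R} H.

(* Main.v *)
Require Import Defs.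
From HB Require Import structures.
From mathcomp Require Import all_boot all_order all_algebra.
From mathcomp Require Import complex ring.
From mathcomp Require Import all_classical all_reals all_analysis.
Set Implicit Arguments.
Unset Strict Implicit.
Unset Printing Implicit Defensive.
Import Order.TTheory GRing.Theory Num.Theory.
Import numFieldNormedType.Exports.
Local Open Scope classical_set_scope.
Local Open Scope ring_scope.

(* An infinite dimensional H carries a non-surjective isometry V, with V^* e = 0
   for some e != 0.  The projection P onto H (+) ker V^* then lies in the Riemann
   sphere, satisfies p0 P = p0 and fixes (0, e).  If Q is an idempotent with
   |P - Q| < 1, then P maps the range of Q onto the range of P (Neumann series),
   so P q = (0, e) for some q in the range of Q, whence p0 q = p0 P q = 0 and
   |(p0 - Q) q| = |q|: the unit ball around P misses the set in question. *)

(** * Sequences and limits in normed modules *)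

(** The bound forces [a] to be nondecreasing, hence convergent, and its Cauchy property carries over
    to [u]. The exponent [k.+1] is 2 for orthogonal series, where Pythagoras controls squared norms,
    and 1 for the geometric bound of the Neumann series. *)
Lemma cvgn_dominated (R : realType) (V : completeNormedModType R[i]) (k : nat)
    (u : nat -> V) (a : nat -> R) (M : R) :
  (forall n, a n <= M) ->
  (forall m n, (m <= n)%N -> `|u n - u m| ^+ k.+1 <= (a n - a m)%:C%C) ->
  cvgn u.
Proof.
move=> aM ua.
have nda : nondecreasing_seq a.
  move=> m n mn; rewrite -subr_ge0 -lecR.
  by rewrite (le_trans _ (ua _ _ mn))// exprn_ge0.
have ca : cvgn a by apply: nondecreasing_is_cvgn => //; exists M => _ [n _ <-].
have al n : a n <= limn a by exact: nondecreasing_cvgn_le.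
apply: cauchy_cvg; apply/cauchy_ballP => e e0.
have e20 : 0 < e / 2 by rewrite divr_gt0.
have eE : (complex.Re (e / 2))%:C%C = e / 2 by rewrite Re_ge0K// ltW.
have r0 : 0 < complex.Re (e / 2) ^+ k.+1.
  by rewrite exprn_gt0// -ltcR eE.
have /cvgrPdist_lt /(_ _ r0) [N _ aN] := ca.
have key n : (N <= n)%N -> `|u n - u N| < e / 2.
  move=> Nn; rewrite -(@ltr_pXn2r _ k.+1) ?nnegrE ?(ltW e20)//.
  rewrite (le_lt_trans (ua _ _ Nn))// -eE -rmorphXn ltcR.
  have /= := aN N (leqnn N); rewrite ger0_norm ?subr_ge0//; apply: le_lt_trans.
  by rewrite lerD2r.
exists (u @` [set n | (N <= n)%N], u @` [set n | (N <= n)%N]) => /=.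
  by split; exists N => // n Nn /=; exists n.
move=> [_ _] [/= [n Nn <-] [m Nm <-]].
rewrite -ball_normE /=.
rewrite (le_lt_trans (ler_distD (u N) _ _))// [ltRHS]splitr ltrD ?key//.
by rewrite distrC key.
Qed.

Lemma cvgn_lipschitz (K : numFieldType) (V W : normedModType K) (f : V -> W)
    (M : K) (u : nat -> V) (l : V) :
  0 <= M -> (forall x y, `|f x - f y| <= M * `|x - y|) ->
  u @ \oo --> l -> f \o u @ \oo --> f l.
Proof.
move=> M0 fM ul; apply/cvgrPdist_lt => e e0 /=.
have M1 : 0 < M + 1 by rewrite ltr_wpDl.
have /cvgrPdist_lt /(_ (e / (M + 1))) := ul.
rewrite divr_gt0// => /(_ isT); apply: filterS => n /=.
rewrite ltr_pdivlMr// mulrC; apply: le_lt_trans.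
by rewrite (le_trans (fM _ _))// ler_wpM2r// lerDl.
Qed.

Lemma limn_lipschitz_eq (K : numFieldType) (V1 V2 W : normedModType K)
    (f1 : V1 -> W) (f2 : V2 -> W) (M1 M2 : K) (u1 : nat -> V1) (u2 : nat -> V2)
    (l1 : V1) (l2 : V2) :
  0 <= M1 -> (forall x y, `|f1 x - f1 y| <= M1 * `|x - y|) ->
  0 <= M2 -> (forall x y, `|f2 x - f2 y| <= M2 * `|x - y|) ->
  u1 @ \oo --> l1 -> u2 @ \oo --> l2 ->
  (forall n, f1 (u1 n) = f2 (u2 n)) -> f1 l1 = f2 l2.
Proof.
move=> M10 f1M M20 f2M /(cvgn_lipschitz M10 f1M) h1 /(cvgn_lipschitz M20 f2M) h2.
move=> uu; apply: (cvg_unique _ h1) => //.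
by rewrite (_ : f1 \o u1 = f2 \o u2)//; apply/funext => n /=.
Qed.

Lemma limn_norm_le (K : numFieldType) (V : normedModType K) (u : nat -> V)
    (l : V) (M : K) :
  0 <= M -> (forall n, `|u n| <= M) -> u @ \oo --> l -> `|l| <= M.
Proof.
move=> M0 uM ul; have := real_leP (normr_real l) (ger0_real M0); case=> // Ml.
have /cvgrPdist_lt /(_ (`|l| - M)) := ul.
rewrite subr_gt0 => /(_ Ml) [N _ /(_ N (leqnn N))] /=.
rewrite ltrBrDl => h; suff : `|l| < `|l| by rewrite ltxx.
apply: le_lt_trans h; rewrite addrC -[in leLHS](subrK (u N) l).
by rewrite (le_trans (ler_normD _ _))// lerD2l.
Qed.

(** * Inner product calculus *)

Section hilbert.
Context {R : realType} {H : hilbertType R}.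
Implicit Types (x y z : H) (f g h : nat -> H).

Lemma innerDl x y z : inner (x + y) z = inner x z + inner y z.
Proof. exact: linearDl. Qed.

Lemma innerDr x y z : inner x (y + z) = inner x y + inner x z.
Proof. exact: linearDr. Qed.

Lemma innerBl x y z : inner (x - y) z = inner x z - inner y z.
Proof. exact: linearBl. Qed.

Lemma innerBr x y z : inner x (y - z) = inner x y - inner x z.
Proof. exact: linearBr. Qed.

Lemma inner0l x : inner 0 x = 0.
Proof. exact: linear0l. Qed.

Lemma inner0r x : inner x 0 = 0.
Proof. exact: linear0r. Qed.

Lemma innerZl (c : R[i]) x y : inner (c *: x) y = c * inner x y.
Proof. exact: linearZl_LR. Qed.

Lemma innerZr (c : R[i]) x y : inner x (c *: y) = c^* * inner x y.
Proof. exact: linearZr_LR. Qed.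

Lemma inner_conj x y : inner x y = (inner y x)^*.
Proof. by rewrite hermC expr0 mul1r. Qed.

Lemma inner_suml I (r : seq I) (P : pred I) (F : I -> H) y :
  inner (\sum_(i <- r | P i) F i) y = \sum_(i <- r | P i) inner (F i) y.
Proof. exact: linear_sumlz. Qed.

Lemma inner_sumr I (r : seq I) (P : pred I) (F : I -> H) y :
  inner y (\sum_(i <- r | P i) F i) = \sum_(i <- r | P i) inner y (F i).
Proof. exact: linear_sumr. Qed.

Lemma inner_injl x y : (forall z, inner x z = inner y z) -> x = y.
Proof.
move=> xy; apply/eqP; rewrite -subr_eq0 -normr_eq0 -sqrf_eq0 -innerE.
by rewrite innerBl xy subrr.
Qed.

Lemma inner_injr x y : (forall z, inner z x = inner z y) -> x = y.
Proof. by move=> xy; apply: inner_injl => z; rewrite inner_conj xy -inner_conj. Qed.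

Lemma cauchy_schwarz x y : `|inner x y| <= `|x| * `|y|.
Proof.
have [->|y0] := eqVneq y 0; first by rewrite inner0r !normr0 mulr0.
have yp : 0 < `|y| ^+ 2 by rewrite exprn_gt0// normr_gt0.
rewrite -(@ler_pXn2r _ 2) ?nnegrE ?mulr_ge0// exprMn -subr_ge0.
rewrite -(pmulr_rge0 _ yp).
(* Expanding this square gives |y|^2 (|x|^2 |y|^2 - |<x,y>|^2). Scaling the projection residue by
   |y|^2 avoids a division. *)
have : 0 <= `| `|y| ^+ 2 *: x - inner x y *: y| ^+ 2 by rewrite exprn_ge0.
rewrite -innerE innerBl !innerBr !innerZl !innerZr !innerE.
rewrite (inner_conj y x) (geC0_conj (ltW yp)) [X in _ <= _ * (_ - X)]normCK.
set b := (inner x y)^*; congr (0 <= _).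
by ring.
Qed.

End hilbert.

(** * Orthonormal sequences and the shift *)

Section orthonormal_sequences.
Context {R : realType} {H : hilbertType R}.
Implicit Types (x y z : H) (f g h : nat -> H).

Definition orthonormal_seq f := forall i j, inner (f i) (f j) = (i == j)%:R.

(** Orthogonality is asked only for indices below [n], so that the formula also serves for the
    finite lists built in [exists_orthonormal_seq]. *)
Lemma inner_orthonormal_sum f n (c : nat -> R[i]) j :
  (forall i, (i < n)%N -> inner (f i) (f j) = (i == j)%:R) -> (j < n)%N ->
  inner (\sum_(0 <= i < n) c i *: f i) (f j) = c j.
Proof.
move=> fj jn; rewrite inner_suml big_mkord (bigD1 (Ordinal jn))//= big1.
  by rewrite innerZl fj// eqxx mulr1 addr0.
move=> i; rewrite -val_eqE/= => /negPf ij.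
by rewrite innerZl fj// ij mulr0.
Qed.

(** Unit vectors are chosen recursively, each orthogonal to the finitely many earlier ones. If none
    existed, every x would equal its Fourier sum over those vectors and H would be finite
    dimensional. *)
Lemma exists_orthonormal_seq :
  ~ finite_dimensional H -> exists f, orthonormal_seq f.
Proof.
move=> infH.
(* The existential stands outside the implication so that [choice] yields a total function on lists;
   a list that is not orthonormal receives the default 0. *)
have step (s : seq H) : exists v,
    (forall i j, (i < size s)%N -> (j < size s)%N ->
      inner s`_i s`_j = (i == j)%:R) ->
    inner v v = 1 /\ forall i, (i < size s)%N -> inner v s`_i = 0.
  have [so|nso] := pselect (forall i j, (i < size s)%N -> (j < size s)%N ->
      inner s`_i s`_j = (i == j)%:R); last by exists 0 => /nso.
  have [[w w0 ws]|nw] := pselect (exists2 w, w != 0 &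
      forall i, (i < size s)%N -> inner w s`_i = 0).
    exists (`|w|^-1 *: w) => _; split=> [|i /ws wi]; last first.
      by rewrite innerZl wi mulr0.
    by rewrite innerE normrZ normfV normr_id mulVf ?expr1n// normr_eq0.
  exfalso; apply: infH; exists (size s), (fun i => s`_i) => x.
  exists (fun i => inner x s`_i); apply/eqP; rewrite -subr_eq0; apply/eqP.
  apply: contrapT => /eqP y0; apply: nw; eexists; first exact: y0.
  move=> j js; rewrite -(big_mkord xpredT (fun i => inner x s`_i *: s`_i)).
  by rewrite innerBl inner_orthonormal_sum ?subrr// => i ilt; exact: so.
have [next nextP] := choice step.
(* [s n] lists the first n chosen vectors, and [f n] is the vector appended next. *)
pose s := fix s n := if n is m.+1 then rcons (s m) (next (s m)) else [::].
have sizes n : size (s n) = n by elim: n => //= n IH; rewrite size_rcons IH.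
pose f n := next (s n).
have sE n i : (i < n)%N -> (s n)`_i = f i.
  elim: n => //= n IH; rewrite ltnS nth_rcons sizes leq_eqVlt.
  by move=> /predU1P[->|iln]; [rewrite ltnn eqxx|rewrite iln IH].
have fo n i j : (i < n)%N -> (j < n)%N -> inner (f i) (f j) = (i == j)%:R.
  elim: n i j => // n IH i j.
  have [] := nextP (s n).
    by move=> k l; rewrite sizes => kn ln; rewrite !sE// IH.
  rewrite -/(f n) sizes => fn1 fn0.
  have {}fn0 k : (k < n)%N -> inner (f n) (f k) = 0.
    by move=> kn; rewrite -(sE n k)// fn0.
  rewrite !ltnS (leq_eqVlt i) (leq_eqVlt j) => /predU1P[->|iln] /predU1P[->|jn].
  - by rewrite eqxx.
  - by rewrite fn0// gtn_eqF.
  - by rewrite inner_conj fn0// conjC0 ltn_eqF.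
  - exact: IH.
by exists f => i j; apply: (fo (maxn i j).+1); rewrite ltnS ?leq_maxl ?leq_maxr.
Qed.

Lemma orthonormal_sum_norm g (c : nat -> R[i]) m n : orthonormal_seq g ->
  `|\sum_(m <= i < n) c i *: g i| ^+ 2 = \sum_(m <= i < n) `|c i| ^+ 2.
Proof.
move=> go; rewrite -innerE inner_suml; apply: eq_big_nat => i imn.
rewrite innerZl inner_sumr (bigD1_seq i) ?iota_uniq ?mem_index_iota//=.
rewrite innerZr go eqxx mulr1 big1 ?addr0 ?normCK// => j /negPf ji.
by rewrite innerZr go eq_sym ji mulr0.
Qed.

(** The partial Fourier sum s is orthogonal to x - s, so |x|^2 = |x - s|^2 + |s|^2. *)
Lemma bessel f x n : orthonormal_seq f ->
  \sum_(0 <= i < n) `|inner x (f i)| ^+ 2 <= `|x| ^+ 2.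
Proof.
move=> fo; rewrite -(orthonormal_sum_norm (fun i => inner x (f i)) 0 n fo).
set s := \sum_(_ <= _ < _) _.
have s0 : inner (x - s) s = 0.
  rewrite inner_sumr big_nat big1// => i /andP[_ ilt].
  by rewrite innerZr innerBl inner_orthonormal_sum ?subrr ?mulr0// => *; exact: fo.
have s1 : 0 <= inner (x - s) (x - s) by rewrite innerE exprn_ge0.
by rewrite -(subrK s x) -!innerE (hnormDd s0) lerDr.
Qed.

(* For orthonormal f and g, the partial isometry sending f_i to g_i and killing
   the orthogonal complement of f; otherwise the limit may be a junk value. *)
Definition transfer f g x : H :=
  limn (fun n => \sum_(0 <= i < n) inner x (f i) *: g i).

(** The squared increments of the series are exactly the increments of the sums of |<x, f_i>|^2,
    which Bessel bounds by |x|^2. *)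
Lemma transfer_cvg f g x : orthonormal_seq f -> orthonormal_seq g ->
  \sum_(0 <= i < n) inner x (f i) *: g i @[n --> \oo] --> transfer f g x.
Proof.
move=> fo go; apply: (@cvgn_dominated _ _ 1 _
  (fun n => complex.Re (\sum_(0 <= i < n) `|inner x (f i)| ^+ 2))
  (complex.Re (`|x| ^+ 2))).
  by move=> n; rewrite -lecR !Re_ge0K ?bessel ?exprn_ge0 ?sumr_ge0.
move=> m n mn; rewrite rmorphB/= !Re_ge0K ?sumr_ge0//.
have split (W : nmodType) (F : nat -> W) : \sum_(0 <= i < n) F i =
    \sum_(0 <= i < m) F i + \sum_(m <= i < n) F i.
  by rewrite (big_cat_nat (n := m)).
by rewrite !split !(addrAC _ _ (- _)) !subrr !add0r orthonormal_sum_norm.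
Qed.

Lemma transfer_linear f g : orthonormal_seq f -> orthonormal_seq g ->
  linear (transfer f g).
Proof.
move=> fo go a x y; apply: cvg_lim => //.
rewrite (_ : (fun n => _) = (fun n =>
    a *: (\sum_(0 <= i < n) inner x (f i) *: g i) +
    \sum_(0 <= i < n) inner y (f i) *: g i)).
  by apply: cvgD; [apply: cvgZr|]; apply: transfer_cvg.
apply/funext => n; rewrite scaler_sumr -big_split/=; apply: eq_bigr => i _.
by rewrite innerDl innerZl scalerDl scalerA.
Qed.

Lemma transfer_le f g x : orthonormal_seq f -> orthonormal_seq g ->
  `|transfer f g x| <= `|x|.
Proof.
move=> fo go; apply: (limn_norm_le (normr_ge0 x) _ (transfer_cvg fo go)) => n.
by rewrite -(@ler_pXn2r _ 2) ?nnegrE// orthonormal_sum_norm// bessel.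
Qed.

(** On both sides the partial sums give the sum of <x, f_i> <g_i, y>; Cauchy-Schwarz makes the inner
    product Lipschitz in each argument, so the equality survives in the limit. *)
Lemma transfer_adjoint f g x y : orthonormal_seq f -> orthonormal_seq g ->
  inner (transfer f g x) y = inner x (transfer g f y).
Proof.
move=> fo go.
have xr y1 y2 : `|inner x y1 - inner x y2| <= `|x| * `|y1 - y2|.
  by rewrite -innerBr cauchy_schwarz.
have yl x1 x2 : `|inner x1 y - inner x2 y| <= `|y| * `|x1 - x2|.
  by rewrite -innerBl mulrC cauchy_schwarz.
apply: (limn_lipschitz_eq (normr_ge0 y) yl (normr_ge0 x) xr
  (transfer_cvg fo go) (transfer_cvg go fo)) => n.
rewrite inner_suml inner_sumr; apply: eq_bigr => i _.
by rewrite innerZl innerZr -inner_conj mulrC.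
Qed.

Lemma transfer_orthonormal f g i : orthonormal_seq f -> orthonormal_seq g ->
  transfer f g (f i) = g i.
Proof.
move=> fo go; apply: cvg_lim => //.
(* The partial sums are constant once they include the index i, that is from n = i + 1 on. *)
apply: cvg_near_cst; exists i.+1 => // n /= ilt.
rewrite big_mkord (bigD1 (Ordinal ilt))//= fo eqxx scale1r big1 ?addr0//.
by move=> j; rewrite -val_eqE/= eq_sym fo => /negPf->; rewrite scale0r.
Qed.

(** The two series agree term by term: moving [transfer f g] across the inner product turns
    <transfer f g x, g_i> into <x, f_i>. *)
Lemma transfer_comp f g h x : orthonormal_seq f -> orthonormal_seq g ->
  transfer g h (transfer f g x) = transfer f h x.
Proof.
move=> fo go; rewrite /transfer -/(transfer f g x).
congr (limn _); apply/funext => n; apply: eq_bigr => i _.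
by rewrite transfer_adjoint// transfer_orthonormal.
Qed.

Lemma transfer_bounded f g : orthonormal_seq f -> orthonormal_seq g ->
  transfer f g \in @bounded_linear R[i] H H.
Proof.
move=> fo go; apply/asboolP; split; first exact: transfer_linear.
by exists 1 => x; rewrite mul1r transfer_le.
Qed.

Lemma orthonormal_seq_shift f : orthonormal_seq f -> orthonormal_seq (f \o S).
Proof. by move=> fo i j; rewrite /= fo eqSS. Qed.

Lemma transfer_shift_initial f g x : orthonormal_seq f -> orthonormal_seq g ->
  transfer (f \o S) g (transfer f f x) = transfer (f \o S) g x.
Proof.
move=> fo go; rewrite /transfer -/(transfer f f x).
congr (limn _); apply/funext => n; apply: eq_bigr => i _.
by rewrite transfer_adjoint// (transfer_orthonormal i.+1).
Qed.

(** This is the adjoint of [transfer_shift_initial], tested against an arbitrary y. *)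
Lemma transfer_shift_final f g x : orthonormal_seq f -> orthonormal_seq g ->
  transfer f f (transfer g (f \o S) x) = transfer g (f \o S) x.
Proof.
move=> fo go; have fSo := orthonormal_seq_shift fo; apply: inner_injl => y.
by rewrite !transfer_adjoint// transfer_shift_initial.
Qed.

(* The unilateral shift on the closed span of an orthonormal sequence, extended
   by the identity on the orthogonal complement. *)
Lemma exists_proper_isometry : ~ finite_dimensional H ->
  exists (V W : boundedOp H H) e,
    [/\ is_adjoint V W, op_comp W V = op_id H, e != 0 & W e = 0].
Proof.
move=> /exists_orthonormal_seq[f fo]; have fSo := orthonormal_seq_shift fo.
(* [E] projects onto the closed span of f, [T] sends f_i to f_(i+1), and [T'] is the adjoint of [T].
   The isometry is 1 - E + T, and f_0 is orthogonal to its range. *)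
pose E := BoundedOp (transfer_bounded fo fo).
pose T := BoundedOp (transfer_bounded fo fSo).
pose T' := BoundedOp (transfer_bounded fSo fo).
have EE x : E (E x) = E x by exact: transfer_comp.
have ET x : E (T x) = T x by exact: transfer_shift_final.
have T'E x : T' (E x) = T' x by exact: transfer_shift_initial.
have T'T x : T' (T x) = E x by exact: transfer_comp.
have VE x : (op_id H - E + T) x = x - E x + T x by [].
have WE x : (op_id H - E + T') x = x - E x + T' x by [].
exists (op_id H - E + T), (op_id H - E + T'), (f 0%N); split.
- by move=> x y; rewrite VE WE innerDl innerBl innerDr innerBr !transfer_adjoint.
- apply/val_inj/funext => x.
  change ((op_id H - E + T') ((op_id H - E + T) x) = x).
  have lin (A : boundedOp H H) y z w : A (y - z + w) = A y - A z + A w.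
    by rewrite linearD linearB.
  (* Writing Vx = x - Ex + Tx, one has E(Vx) = Tx and T'(Vx) = Ex, so everything but x cancels. *)
  rewrite WE VE !lin EE ET T'E T'T !subrr !add0r.
  by rewrite addrK subrK.
- apply/eqP => f0; have /eqP := fo 0%N 0%N.
  by rewrite f0 inner0l eq_sym oner_eq0.
- have Ef : E (f 0%N) = f 0%N by exact: transfer_orthonormal.
  have Tf : T' (f 0%N) = 0.
    apply: cvg_lim => //; apply: cvg_near_cst; apply: nearW => n.
    by rewrite big1// => i _; rewrite fo/= scale0r.
  by rewrite WE Ef Tf subrr addr0.
Qed.

End orthonormal_sequences.

(** * Neumann series, idempotents and adjoints *)

Section operators.
Context {R : realType}.
Implicit Types H K L : hilbertType R.

Lemma boundedOp_eq H K (S T : boundedOp H K) : (forall x, S x = T x) -> S = T.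
Proof. by move=> ST; apply/val_inj/funext. Qed.

Lemma op_compE H K L (S : boundedOp K L) (T : boundedOp H K) x :
  op_comp S T x = S (T x).
Proof. by []. Qed.

(** The iterates of z -> e + A z from 0 are the partial sums of the Neumann series; their increments
    are at most |A|^n |e|, which is summable. *)
Lemma neumann_fixed_point H (A : boundedOp H H) (e : H) :
  `|A| < 1 -> exists z, z = e + A z.
Proof.
move=> A1; pose c := `|A|; pose u n := iter n (fun z => e + A z) 0.
have c0 : 0 <= c := normr_ge0 A.
have A_lip x y : `|A x - A y| <= c * `|x - y|.
  by rewrite -linearB; exact: (op_norm_ub A).
have ustep n : `|u n.+1 - u n| <= c ^+ n * `|e|.
  elim: n => [|n IH]; first by rewrite /= linear0 addr0 subr0 mul1r.
  rewrite [u n.+2]/= [in X in _ - X]/= [e + _]addrC addrKA.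
  by rewrite (le_trans (A_lip _ _))// exprS -mulrA ler_wpM2l.
pose s n := \sum_(0 <= i < n) c ^+ i * `|e|.
have s0 n : 0 <= s n by rewrite sumr_ge0// => i _; rewrite mulr_ge0// exprn_ge0.
have sM n : s n <= `|e| / (1 - c).
  rewrite ler_pdivlMr ?subr_gt0// /s -mulr_suml mulrAC.
  rewrite (_ : _ * (1 - c) = 1 - c ^+ n) ?ler_piMl// ?gerBl ?exprn_ge0//.
  by rewrite big_mkord mulrC -[1 - c]opprB mulNr -subrX1 opprB.
have M0 : 0 <= `|e| / (1 - c) by rewrite divr_ge0// subr_ge0 ltW.
have cu : cvgn u.
  apply: (@cvgn_dominated _ _ 0 _ (fun n => complex.Re (s n))
    (complex.Re (`|e| / (1 - c)))).
    by move=> n; rewrite -lecR !Re_ge0K.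
  move=> m n mn; rewrite expr1 rmorphB/= !Re_ge0K//.
  rewrite /s (big_cat_nat (n := m))//= addrAC subrr add0r.
  rewrite -(telescope_sumr u mn) (le_trans (ler_norm_sum _ _ _))//.
  exact: ler_sum.
exists (limn u).
pose g z := e + A z.
have g_lip x y : `|g x - g y| <= c * `|x - y| by rewrite /g opprD addrACA subrr add0r.
have id_lip (x y : H) : `|idfun x - idfun y| <= 1 * `|x - y| by rewrite mul1r.
(* The limit is taken on both sides of u_(n+1) = e + A u_n. *)
apply: (limn_lipschitz_eq (f1 := idfun) (f2 := g) ler01 id_lip c0 g_lip
  (u1 := fun n => u n.+1) (u2 := u)) => //.
by rewrite (cvg_shiftS u).
Qed.

Lemma norm_sub_idempotent_nlt1 H (P0 P Q : boundedOp H H) (e : H) :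
  op_comp P P = P -> op_comp Q Q = Q -> op_comp P0 P = P0 ->
  e != 0 -> P e = e -> P0 e = 0 ->
  `|P - Q| < 1 -> ~ `|P0 - Q| < 1.
Proof.
move=> PP QQ P0P e0 Pe P0e PQ1 P0Q1.
have [z zE] := neumann_fixed_point e PQ1.
have PPE x : P (P x) = P x by rewrite -op_compE PP.
have QQE x : Q (Q x) = Q x by rewrite -op_compE QQ.
have P0PE x : P0 (P x) = P0 x by rewrite -op_compE P0P.
(* Applying P to z = e + Pz - Qz gives Pz = e + Pz - PQz. *)
have PQz : P (Q z) = e.
  have /eqP : P z = P e + (P (P z) - P (Q z)) by rewrite {1}zE linearD linearB.
  by rewrite Pe PPE addrCA -{1}[P z]addr0 (inj_eq (addrI _)) eq_sym subr_eq0 => /eqP.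
have Qz0 : Q z != 0 by apply: contraNneq e0 => Qz; rewrite -PQz Qz linear0.
have := op_norm_ub (P0 - Q) (Q z).
(* [P0 - Q] sends the nonzero vector Qz to -Qz, because P0 Qz = P0 PQz = P0 e = 0; its norm is
   therefore not below 1. *)
rewrite [X in `|X|](_ : _ = P0 (Q z) - Q (Q z))// QQE -P0PE PQz P0e sub0r normrN.
have : op_norm (P0 - Q) * `|Q z| < `|Q z| by rewrite gtr_pMl ?normr_gt0.
by move=> /le_lt_trans lt_norm /lt_norm; rewrite ltxx.
Qed.

Lemma is_adjoint_uniq H K (T : boundedOp H K) (S S' : boundedOp K H) :
  is_adjoint T S -> is_adjoint T S' -> S = S'.
Proof.
move=> TS TS'; apply: boundedOp_eq => x; apply: inner_injr => y.
by rewrite -TS TS'.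
Qed.

Lemma is_adjoint_sym H K (T : boundedOp H K) (S : boundedOp K H) :
  is_adjoint T S -> is_adjoint S T.
Proof. by move=> TS x y; rewrite inner_conj -TS -inner_conj. Qed.

Lemma riemann_sphere_idempotent H P :
  riemann_sphere H P -> op_comp P P = P.
Proof.
move=> [U [V [[V' [UV' _ V'U]] UV PE]]]; apply: boundedOp_eq => x.
(* The inverse [V'] supplied by unitarity is also an adjoint of [U], hence equals [V]. *)
have VU y : V (U y) = y.
  by rewrite (is_adjoint_uniq UV UV') -[RHS]/(op_id _ y) -V'U.
by rewrite PE /= VU.
Qed.

(** * Block operators and the Halmos dilation *)

Section block.
Context {H : hilbertType R}.
Implicit Types A B C D : boundedOp H H.

Definition block_fun A B C D (x : hsum H H) : hsum H H :=
  (A x.1 + B x.2, C x.1 + D x.2).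

Lemma block_bounded A B C D :
  block_fun A B C D \in @bounded_linear R[i] (hsum H H) (hsum H H).
Proof.
apply/asboolP; split=> [a x y|].
  by congr pair; rewrite /= !linearP scalerDr addrACA.
exists (op_norm A + op_norm B + (op_norm C + op_norm D)) => x.
rewrite (le_trans (hsum_norm_le _))//= !mulrDl.
have le1 (T : boundedOp H H) : `|T x.1| <= op_norm T * `|x|.
  by rewrite (le_trans (op_norm_ub T _))// ler_wpM2l ?op_norm_ge0 ?hsum_norm1.
have le2 (T : boundedOp H H) : `|T x.2| <= op_norm T * `|x|.
  by rewrite (le_trans (op_norm_ub T _))// ler_wpM2l ?op_norm_ge0 ?hsum_norm2.
by rewrite lerD// (le_trans (ler_normD _ _))// lerD.
Qed.

Definition block_op A B C D : boundedOp (hsum H H) (hsum H H) :=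
  BoundedOp (block_bounded A B C D).

Lemma block_op_adjoint A B C D A' B' C' D' :
  is_adjoint A A' -> is_adjoint B B' -> is_adjoint C C' -> is_adjoint D D' ->
  is_adjoint (block_op A B C D) (block_op A' C' B' D').
Proof.
move=> AA BB CC DD x y.
suff : inner (A x.1 + B x.2) y.1 + inner (C x.1 + D x.2) y.2 =
    inner x.1 (A' y.1 + C' y.2) + inner x.2 (B' y.1 + D' y.2) by [].
by rewrite !innerDl !innerDr AA BB CC DD addrACA.
Qed.

(* U below is the Halmos dilation of W = V^*, and P = U proj0 U^* maps (x, y) to
   (x, y - V W y): its range is H (+) ker W. *)
Lemma isometry_riemann_sphere (V W : boundedOp H H) :
  is_adjoint V W -> op_comp W V = op_id H ->
  exists P, [/\ riemann_sphere H P, op_comp (proj0 H) P = proj0 H &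
    forall e, W e = 0 -> P (0, e) = (0, e)].
Proof.
move=> VW WV; have WVE x : W (V x) = x by rewrite -op_compE WV.
(* E = 1 - VW is the orthogonal projection onto ker W; the existential hides its body, leaving only
   the pointwise formula. *)
have [E ED] : exists E : boundedOp H H, forall x, E x = x - V (W x).
  by exists (op_id H - op_comp V W).
have VE x : E (V x) = 0 by rewrite ED WVE subrr.
have WE x : W (E x) = 0 by rewrite ED linearB/= WVE subrr.
have EE x : E (E x) = E x by rewrite [LHS]ED WE linear0 subr0.
have lin (A : boundedOp H H) y z : A (y + z) = A y + A z by rewrite linearD.
have adjE : is_adjoint E E.
  by move=> x y; rewrite !ED innerBl innerBr VW (is_adjoint_sym VW).
have adj0 : is_adjoint (0 : boundedOp H H) 0.
  by move=> x y; rewrite [LHS]inner0l [RHS]inner0r.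
(* Unitarity of [U] will follow from WV = 1, WE = 0, EV = 0, EE = E and VW + E = 1. *)
pose U := block_op W 0 E V; pose U' := block_op V E 0 W.
have UE (x y : H) : U (x, y) = (W x, E x + V y).
  by rewrite -[W x]addr0.
have U'E (x y : H) : U' (x, y) = (V x + E y, W y).
  by rewrite -[W y]add0r.
have UU' : is_adjoint U U'.
  by apply: block_op_adjoint => //; exact: is_adjoint_sym.
have P0E (x y : H) : proj0 H (x, y) = (x, 0) by [].
have PE (x y : H) : op_comp (op_comp U (proj0 H)) U' (x, y) = (x, E y).
  rewrite !op_compE U'E P0E UE linear0 addr0.
  by rewrite !lin WVE WE VE EE addr0 add0r.
exists (op_comp (op_comp U (proj0 H)) U'); split.
- exists U, U'; split=> //; exists U'; split=> //.
    apply: boundedOp_eq => -[x y]; rewrite op_compE U'E UE.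
    by rewrite !lin WVE WE VE EE addr0 add0r ED subrK.
  apply: boundedOp_eq => -[x y]; rewrite op_compE UE U'E.
  by rewrite !lin WVE WE VE EE addr0 add0r ED addrC subrK.
- by apply: boundedOp_eq => -[x y]; rewrite op_compE PE.
- by move=> e We; rewrite PE ED We linear0 subr0.
Qed.
End block.

End operators.

Theorem mainTheorem18 (R : realType) (H : hilbertType R)
    (infH : ~ finite_dimensional H) :
  ~ dense [set P : riemann_sphere H | `|proj0 H - \val P| < 1].
Proof.
move=> dR; have [V [W [e [VW WV e0 We]]]] := exists_proper_isometry infH.
have [P [RP P0P PE]] := isometry_riemann_sphere VW WV.
have e0' : (0, e) != 0 :> hsum H H by apply: contraNneq e0 => -[->].
have far Q : riemann_sphere H Q -> `|P - Q| < 1 -> ~ `|proj0 H - Q| < 1.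
  move=> /riemann_sphere_idempotent QQ.
  exact: (norm_sub_idempotent_nlt1 (riemann_sphere_idempotent RP) QQ P0P e0'
    (PE e We) erefl).
pose B := [set T | `|P - T| < 1].
have oB : open B.
  have : open (ball P 1) by exact: ball_open.
  by rewrite -ball_normE.
have oO : open (\val @^-1` B : set (riemann_sphere H)) by exists B.
(* The trace of [B] on the sphere is open and contains P, so density would give a Q at distance less
   than 1 from both P and [proj0 H]. *)
have [|Q [PQ P0Q]] := dR (\val @^-1` B) _ oO.
  by exists (exist _ P (mem_set RP)); rewrite /B /preimage /= subrr normr0.
exact: far (set_valP Q) PQ P0Q.
Qed.
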